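(* Let $\|\cdot\|$ be a norm on $\mathbb{R}^d$, $\mathcal{X}\subseteq\mathbb{R}^d$ with $B=\sup_{x\in\mathcal{X}}\|x\|<\infty$, and $\gamma>0$. There is an online learner such that for every sequence $(x_1,y_1),\dots,(x_T,y_T)\in\mathcal{X}\times\{-1,+1\}$, $$\sum_{t=1}^T\mathbb{E}\,\mathbb{1}[\hat y_t\neq y_t]-\min_{w\in\mathbb{R}^d,\ \|w\|_\star=1}\sum_{t=1}^T\mathbb{1}[y_t\langle w,x_t\rangle\le\gamma]\le\sqrt{T\cdot d\ln\!\left(1+\frac{2B}{\gamma}\right)}.$$
   Context: Online binary classification: on rounds $t=1,\dots,T$ the adversary reveals $x_t\in\mathcal{X}$, the (possibly randomized) learner outputs $\hat y_t\in\{-1,+1\}$, then $y_t\in\{-1,+1\}$ is revealed; the expectation is over the learner's randomness. $\|w\|_\star=\sup_{\|x\|\le1}\langle w,x\rangle$ is the dual norm. *)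

(* Defs.v *)
From HB Require Import structures.
From mathcomp Require Import all_boot all_order all_algebra.
From mathcomp Require Import all_classical all_reals all_analysis.
Set Implicit Arguments. Unset Strict Implicit. Unset Printing Implicit Defensive.
Import Order.TTheory GRing.Theory Num.Theory.
Local Open Scope ring_scope.
Local Open Scope classical_set_scope.

Section OnlineDefs.
Variables (R : realType) (d : nat).

Definition dotv (w x : 'rV[R]_d) : R := \sum_(i < d) w ord0 i * x ord0 i.

Definition is_norm (N : 'rV[R]_d -> R) : Prop :=
  [/\ forall x, N x = 0 -> x = 0,
      forall (a : R) x, N (a *: x) = `|a| * N x
    & forall x y, N (x + y) <= N x + N y].

Definition dual_norm (N : 'rV[R]_d -> R) (w : 'rV[R]_d) : R :=
  sup [set dotv w x | x in [set x | N x <= 1]].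

(* labels in {-1,+1}, encoded by bool (true = +1) *)
Definition sgn (b : bool) : R := if b then 1 else -1.

(* A (randomized) online learner: given the history of revealed pairs
   (x_1,y_1),...,(x_{t-1},y_{t-1}) and the current x_t, it outputs the
   probability of predicting +1. *)
Definition learner := seq ('rV[R]_d * bool) -> 'rV[R]_d -> R.

Definition history (x : nat -> 'rV[R]_d) (y : nat -> bool) (t : nat) :=
  [seq (x s, y s) | s <- iota 0 t].

(* E 1[hat y_t <> y_t] at round t (rounds indexed from 0) *)
Definition exp_mistake (L : learner) (x : nat -> 'rV[R]_d) (y : nat -> bool)
  (t : nat) : R :=
  let p := L (history x y t) (x t) in if y t then 1 - p else p.

Definition margin_err (gamma : R) (w : 'rV[R]_d) (x : nat -> 'rV[R]_d)
  (y : nat -> bool) (t : nat) : R :=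
  if sgn (y t) * dotv w (x t) <= gamma then 1 else 0.

End OnlineDefs.

(* Main.v *)
(** Let [K] be the set of [w] with [|<w, x>| <= N x] for all [x]. A maximal
    family of points of [K] that are pairwise at distance more than [gamma] for
    [w |-> sup_(x in X) |<w, x>|] is a [gamma]-cover of [K], so each [w] of dual
    norm 1 is dominated by the halfspace of some point of the family: it errs
    only where [w] fails the margin [gamma]. Hedge on these [M] halfspaces has
    regret [sqrt (T ln M)] if [T >= 4 ln M]; otherwise coin flips suffice.

    The bound [M <= q^d], [q = 1 + 2B/gamma], is obtained without volumes. With
    [eta = 1/q], the [M^s] sums [p_(i_0) + eta p_(i_1) + ... + eta^(s-1) p_(i_(s-1))]
    stay in a fixed bounded set and are separated by [gamma eta^s]; counting cells
    of a grid of that mesh gives [M^s <= D q^(s d)] with [D] independent of [s],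
    and [s] goes to infinity. *)
Require Import Defs.
From HB Require Import structures.
From mathcomp Require Import all_boot all_order all_algebra.
From mathcomp Require Import all_classical all_reals all_analysis.
From mathcomp Require Import ring lra.
Set Implicit Arguments. Unset Strict Implicit. Unset Printing Implicit Defensive.
Import Order.TTheory GRing.Theory Num.Theory.
Local Open Scope ring_scope.
Local Open Scope classical_set_scope.

(** * Elementary exponential inequalities *)

(** For [x <= 0], [expR x <= 1 / (1 - x)] and [(1 - x) * (1 + x + x ^+ 2) = 1 - x ^+ 3 >= 1]. For
    [0 < x <= 1], the quotient [f] of the two sides is nondecreasing on the unit interval and
    [f 0 = 1]. *)
Lemma expR_le_quadratic (R : realType) (x : R) :
  -1 <= x <= 1 -> expR x <= 1 + x + x ^+ 2.
Proof.
move=> /andP[xN1 x1].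
have q0 : 0 < 1 + x + x ^+ 2 by nra.
have [x0|x0] := lerP x 0.
  rewrite -[x in expR x]opprK expRN -[leRHS]invrK.
  rewrite lef_pV2 ?posrE ?expR_gt0 ?invr_gt0//.
  apply: le_trans (expR_ge1Dx (- x)).
  rewrite -div1r ler_pdivrMr//; nra.
pose f := (fun y : R => (1 + y + y ^+ 2) * expR (- y)).
have df (y : R) : is_derive y 1 f (y * (1 - y) * expR (- y)).
  have dq : is_derive y 1 (fun z : R => 1 + z + z ^+ 2) (1 + 2 * y).
    apply: is_derive_eq; rewrite /GRing.scale /=; ring.
  have de : is_derive y 1 (fun z : R => expR (- z)) (- expR (- y)).
    by apply: is_derive_eq; rewrite /GRing.scale /= mulrN1.
  rewrite (_ : y * _ * _ = (1 + y + y ^+ 2) *: (- expR (- y)) + expR (- y) *: (1 + 2 * y)).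
    exact: is_deriveM.
  rewrite /GRing.scale /=; ring.
have f01 : f 0 <= f x.
  apply: (@ger0_derive1_ndecr _ f 0 1) => //.
  - move=> y; rewrite in_itv /= => /andP[y0 y1].
    by rewrite derive1E derive_val !mulr_ge0 ?expR_ge0//; lra.
  - by apply: derivable_within_continuous => y _; exact: ex_derive.
  exact: ltW.
move: f01; rewrite /f oppr0 expR0 addr0 expr0n /= addr0 mulr1 expRN.
by rewrite ler_pdivlMr ?expR_gt0// mul1r.
Qed.

(* Multiplied by [expR (a * m)], the left-hand side is [E (expR Z)] for a centred
   [Z] with [`|Z| <= 1] and variance [a^2 m (1 - m) <= a^2 / 4]. *)
Lemma bernoulli_mgf_le (R : realType) (m a : R) :
  0 <= m <= 1 -> 0 <= a <= 1 ->
  1 - m + m * expR (- a) <= expR (a ^+ 2 / 4 - a * m).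
Proof.
move=> /andP[m0 m1] /andP[a0 a1].
have e1 : expR (a * m) <= 1 + a * m + (a * m) ^+ 2.
  by apply: expR_le_quadratic; nra.
have e2 : expR (- (a * (1 - m))) <=
    1 + - (a * (1 - m)) + (- (a * (1 - m))) ^+ 2.
  by apply: expR_le_quadratic; nra.
rewrite expRD (expRN (a * m)) ler_pdivlMr ?expR_gt0//.
have -> : (1 - m + m * expR (- a)) * expR (a * m) =
    (1 - m) * expR (a * m) + m * expR (- (a * (1 - m))).
  have -> : - (a * (1 - m)) = - a + a * m by ring.
  by rewrite expRD; ring.
apply: le_trans (expR_ge1Dx (a ^+ 2 / 4)).
have : (1 - m) * expR (a * m) <= (1 - m) * (1 + a * m + (a * m) ^+ 2).
  by rewrite ler_wpM2l// subr_ge0.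
have : m * expR (- (a * (1 - m))) <=
    m * (1 + - (a * (1 - m)) + (- (a * (1 - m))) ^+ 2) by rewrite ler_wpM2l.
have : 0 <= a ^+ 2 * (m - 1 / 2) ^+ 2 by rewrite mulr_ge0 ?sqr_ge0.
by lra.
Qed.

(** * The Hedge algorithm and its regret *)

Definition expert_weight (R : realType) (d M : nat) (a : R)
    (e : 'I_M -> 'rV[R]_d -> bool) (h : seq ('rV[R]_d * bool)) (i : 'I_M) : R :=
  expR (- (a * (count (fun z => e i z.1 != z.2) h)%:R)).

(** The exponentially weighted vote for +1, with learning rate [a]. For [M = 0] the quotient is
    [0 / 0 = 0], still a probability. *)
Definition hedge (R : realType) (d M : nat) (a : R)
    (e : 'I_M -> 'rV[R]_d -> bool) : learner R d := fun h x =>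
  (\sum_i expert_weight a e h i * (e i x)%:R) /
  (\sum_i expert_weight a e h i).

Lemma hedge_in01 (R : realType) (d M : nat) (a : R)
    (e : 'I_M -> 'rV[R]_d -> bool) h x : 0 <= hedge a e h x <= 1.
Proof.
have W0 : 0 <= \sum_i expert_weight a e h i.
  by apply: sumr_ge0 => i _; exact: expR_ge0.
rewrite /hedge; apply/andP; split.
  by rewrite divr_ge0// sumr_ge0// => i _; rewrite mulr_ge0 ?expR_ge0.
have [->|Wn0] := eqVneq (\sum_i expert_weight a e h i) 0.
  by rewrite invr0 mulr0.
rewrite ler_pdivrMr ?lt0r ?Wn0// mul1r ler_sum// => i _.
by case: (e i x); rewrite ?mulr1// mulr0 expR_ge0.
Qed.

Lemma historyS (R : realType) (d : nat) (x : nat -> 'rV[R]_d) y t :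
  history x y t.+1 = rcons (history x y t) (x t, y t).
Proof. by rewrite /history -[t.+1]addn1 iotaD map_cat cats1. Qed.

Lemma expert_weight_rcons (R : realType) (d M : nat) (a : R)
    (e : 'I_M -> 'rV[R]_d -> bool) h x y i :
  expert_weight a e (rcons h (x, y)) i =
  expert_weight a e h i * expR (- (a * (e i x != y)%:R)).
Proof.
rewrite /expert_weight -cats1 count_cat /= addn0 natrD -expRD.
by congr expR; ring.
Qed.

Lemma exp_mistake_hedge (R : realType) (d M : nat) (a : R)
    (e : 'I_M -> 'rV[R]_d -> bool) x y t : (0 < M)%N ->
  exp_mistake (hedge a e) x y t =
  (\sum_i expert_weight a e (history x y t) i * (e i (x t) != y t)%:R) /
  (\sum_i expert_weight a e (history x y t) i).
Proof.
case: M e => // M e _; rewrite /exp_mistake /hedge.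
set w := expert_weight a e _.
have W0 : 0 < \sum_i w i.
  by rewrite big_ord_recl ltr_pwDl ?expR_gt0// sumr_ge0// => i _; exact: expR_ge0.
case: (y t); last by under [in RHS]eq_bigr do rewrite eqbF_neg negbK.
under [in RHS]eq_bigr do rewrite eqb_id.
apply: (mulIf (lt0r_neq0 W0)); rewrite mulrBl !mulfVK ?lt0r_neq0// mul1r.
rewrite -sumrB; apply: eq_bigr => i _.
by case: (e i (x t)); rewrite ?mulr1 ?mulr0 ?subrr ?subr0.
Qed.

(** Each round multiplies the total weight by exactly [1 - m + m * expR (- a)], with [m] the
    expected mistake of Hedge; [bernoulli_mgf_le] bounds this factor. *)
Lemma hedge_potential (R : realType) (d M : nat) (a : R)
    (e : 'I_M -> 'rV[R]_d -> bool) x y T : (0 < M)%N -> 0 <= a <= 1 ->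
  \sum_i expert_weight a e (history x y T) i <=
  M%:R * expR (T%:R * (a ^+ 2 / 4) - a * \sum_(t < T) exp_mistake (hedge a e) x y t).
Proof.
move=> M0 a01; elim: T => [|T IH].
  rewrite big_ord0 !mul0r mulr0 subr0 expR0 mulr1.
  under eq_bigr do rewrite /expert_weight /= mulr0 oppr0 expR0.
  by rewrite sumr_const card_ord.
set w := expert_weight a e (history x y T) in IH *.
have W0 : 0 < \sum_i w i.
  have [i0] : exists i : 'I_M, true by exists (Ordinal M0).
  by rewrite (bigD1 i0)//= ltr_pwDl ?expR_gt0// sumr_ge0// => i _; exact: expR_ge0.
set m := exp_mistake (hedge a e) x y T.
have mE : m * \sum_i w i = \sum_i w i * (e i (x T) != y T)%:R.
  by rewrite /m exp_mistake_hedge// mulfVK ?lt0r_neq0.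
have m01 : 0 <= m <= 1.
  rewrite /m /exp_mistake; case/andP: (hedge_in01 a e (history x y T) (x T)).
  by case: (y T) => *; apply/andP; split; lra.
have -> : \sum_i expert_weight a e (history x y T.+1) i =
    (\sum_i w i) * (1 - m + m * expR (- a)).
  have -> : (\sum_i w i) * (1 - m + m * expR (- a)) =
      \sum_i w i + (m * \sum_i w i) * (expR (- a) - 1) by ring.
  rewrite mE mulr_suml -big_split /=; apply: eq_bigr => i _.
  rewrite historyS expert_weight_rcons -/w.
  by case: (_ != _); rewrite ?mulr1 ?mulr0 ?oppr0 ?expR0; ring.
rewrite big_ord_recr /= -/m.
have -> : T.+1%:R * (a ^+ 2 / 4) -
    a * (\sum_(i < T) exp_mistake (hedge a e) x y i + m) =
  (T%:R * (a ^+ 2 / 4) - a * \sum_(i < T) exp_mistake (hedge a e) x y i) +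
  (a ^+ 2 / 4 - a * m) by rewrite -natr1; ring.
rewrite expRD mulrA; apply: ler_pM => //; first exact: ltW.
  2: exact: bernoulli_mgf_le.
case/andP: m01 => m0 m1; apply: addr_ge0; first by rewrite subr_ge0.
by rewrite mulr_ge0 ?expR_ge0.
Qed.

(** The weight of expert [i] alone is at most the total weight; take logarithms in [hedge_potential]
    and divide by [a]. *)
Lemma hedge_regret (R : realType) (d M : nat) (a : R)
    (e : 'I_M -> 'rV[R]_d -> bool) x y T (i : 'I_M) : 0 < a <= 1 ->
  \sum_(t < T) exp_mistake (hedge a e) x y t -
    \sum_(t < T) (e i (x t) != y t)%:R <= ln M%:R / a + T%:R * a / 4.
Proof.
move=> /andP[a0 a1]; have M0 : (0 < M)%N by apply: leq_ltn_trans (ltn_ord i).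
have a01 : 0 <= a <= 1 by rewrite a1 ltW.
have := hedge_potential e x y T M0 a01.
set S := \sum_(t < T) exp_mistake _ _ _ _.
have -> : \sum_(t < T) (e i (x t) != y t)%:R =
    (count (fun z => e i z.1 != z.2) (history x y T))%:R :> R.
  elim: T {S} => [|T IH]; first by rewrite big_ord0.
  by rewrite big_ord_recr historyS -cats1 count_cat natrD IH /= addn0.
set c := count _ _.
have wi : expR (- (a * c%:R)) <= \sum_j expert_weight a e (history x y T) j.
  by rewrite (bigD1 i)//= lerDl sumr_ge0// => j _; exact: expR_ge0.
move=> /(le_trans wi).
have MR : 0 < M%:R :> R by rewrite ltr0n.
rewrite -[M%:R in X in X -> _]lnK ?posrE// -expRD ler_expR => H.
have lnE : a * (ln M%:R / a) = ln M%:R by rewrite mulrCA divff ?mulr1 ?lt0r_neq0.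
rewrite -(ler_pM2l a0) [leRHS]mulrDr lnE.
by lra.
Qed.

(** * The pairing [dotv] *)

Lemma dotvD (R : realType) (d : nat) (u v x : 'rV[R]_d) :
  dotv (u + v) x = dotv u x + dotv v x.
Proof. by rewrite /dotv -big_split; apply: eq_bigr => i _; rewrite mxE mulrDl. Qed.

Lemma dotvZ (R : realType) (d : nat) a (u x : 'rV[R]_d) :
  dotv (a *: u) x = a * dotv u x.
Proof. by rewrite /dotv mulr_sumr; apply: eq_bigr => i _; rewrite mxE mulrA. Qed.

Lemma dotvB (R : realType) (d : nat) (u v x : 'rV[R]_d) :
  dotv (u - v) x = dotv u x - dotv v x.
Proof. by rewrite -scaleN1r dotvD dotvZ mulN1r. Qed.

Lemma dotvZr (R : realType) (d : nat) a (u x : 'rV[R]_d) :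
  dotv u (a *: x) = a * dotv u x.
Proof. by rewrite /dotv mulr_sumr; apply: eq_bigr => i _; rewrite mxE; ring. Qed.

Lemma dotv0r (R : realType) (d : nat) (u : 'rV[R]_d) : dotv u 0 = 0.
Proof. by rewrite -(scale0r 0) dotvZr mul0r. Qed.

Lemma dotv_delta (R : realType) (d : nat) (u : 'rV[R]_d) i :
  dotv u (delta_mx ord0 i) = u ord0 i.
Proof.
rewrite /dotv (bigD1 i)//= big1 => [|j ji]; rewrite mxE eqxx /=.
  by rewrite eqxx mulr1 addr0.
by rewrite (negbTE ji) mulr0.
Qed.

Lemma ler_norm_dotv (R : realType) (d : nat) (h : R) (u z : 'rV[R]_d) :
  (forall k, `|u ord0 k| <= h) -> `|dotv u z| <= h * \sum_k `|z ord0 k|.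
Proof.
move=> uh; apply: le_trans (ler_norm_sum _ _ _) _.
by rewrite mulr_sumr ler_sum// => k _; rewrite normrM ler_wpM2r.
Qed.

(** * Packing bound by digit expansions *)

Lemma bernoulli_ineq (R : realType) (t : R) n :
  0 <= t -> 1 + n%:R * t <= (1 + t) ^+ n.
Proof.
move=> t0; elim: n => [|n IH]; first by rewrite mul0r addr0 expr0.
rewrite exprS -natr1.
have := ler_wpM2l (addr_ge0 ler01 t0) IH.
have : 0 <= n%:R * t * t by rewrite !mulr_ge0.
by lra.
Qed.

Lemma le1_of_bounded_powers (R : realType) (a D : R) :
  (forall n, a ^+ n <= D) -> a <= 1.
Proof.
move=> aD; rewrite leNgt; apply/negP => a1.
have t0 : 0 < a - 1 by rewrite subr_gt0.
have := bernoulli_ineq (Num.truncn (D / (a - 1))).+1 (ltW t0).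
have := truncnS_gt (D / (a - 1)); set n := _.+1.
have -> : 1 + (a - 1) = a by ring.
rewrite ltr_pdivrMr// => Dn /le_trans/(_ (aD n)).
by lra.
Qed.

(** Cut the cube of half-side [E] into cells of side [h]: two values in one cell differ by at most
    [h] in each coordinate, so each cell receives at most one index. *)
Lemma card_le_cells (R : realType) (d : nat) (I : finType) (f : I -> 'rV[R]_d)
    (E h : R) : 0 <= E -> 0 < h ->
  (forall u k, `|f u ord0 k| <= E) ->
  (forall u v, (forall k, `|(f u - f v) ord0 k| <= h) -> u = v) ->
  #|I|%:R <= (2 * E / h + 1) ^+ d.
Proof.
move=> E0 h0 fE finj.
pose K := Num.truncn (2 * E / h).
pose c u k := Num.truncn ((f u ord0 k + E) / h).
have cpos u k : 0 <= (f u ord0 k + E) / h.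
  by rewrite divr_ge0 ?(ltW h0)//; have := fE u k; rewrite ler_norml => /andP[]; lra.
have cK u k : (c u k < K.+1)%N.
  rewrite ltnS le_truncn// ler_wpM2r ?invr_ge0 ?(ltW h0)//.
  by have := fE u k; rewrite ler_norml => /andP[]; lra.
pose cell u : {ffun 'I_d -> 'I_K.+1} := [ffun k => Ordinal (cK u k)].
have cell_inj : injective cell.
  move=> u v /ffunP uv; apply: finj => k.
  have := uv k; rewrite !ffunE => -[] ck.
  have /andP[u1 u2] := truncn_itv (cpos u k).
  have /andP[v1 v2] := truncn_itv (cpos v k).
  move: u1 u2 v1 v2; rewrite -/(c u k) -/(c v k) ck !ler_pdivlMr// !ltr_pdivrMr//.
  by rewrite -natr1 !mxE ler_norml => *; apply/andP; split; lra.
have := leq_card cell cell_inj; rewrite card_ffun !card_ord -(ler_nat R) natrX.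
move=> /le_trans; apply; rewrite lerXn2r ?nnegrE ?ler0n//.
  by rewrite addr_ge0// divr_ge0 ?(ltW h0)// mulr_ge0.
by rewrite -natr1 lerD2r truncn_le divr_ge0 ?(ltW h0)// mulr_ge0.
Qed.

(** Horner form of the expansion in powers of [eta], so that induction peels off the leading
    digit. *)
Fixpoint digits_sum (R : realType) (d : nat) (I : Type) (eta : R)
    (p : I -> 'rV[R]_d) (s : seq I) : 'rV[R]_d :=
  if s is i :: s' then p i + eta *: digits_sum eta p s' else 0.

Lemma norm_digits_sum (R : realType) (d : nat) (I : Type) (eta : R)
    (p : I -> 'rV[R]_d) (z : 'rV[R]_d) (B : R) s :
  0 <= eta <= 1 -> (forall i, `|dotv (p i) z| <= B) ->
  (1 - eta) * `|dotv (digits_sum eta p s) z| <= B * (1 - eta ^+ size s).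
Proof.
move=> /andP[eta0 eta1] pB; elim: s => [|i s IH] /=.
  by rewrite -(scale0r 0) dotvZ mul0r normr0 mulr0 expr0 subrr mulr0.
rewrite dotvD dotvZ exprS.
apply: (@le_trans _ _ ((1 - eta) * (B + eta * `|dotv (digits_sum eta p s) z|))).
  rewrite ler_wpM2l ?subr_ge0//; apply: le_trans (ler_normD _ _) _.
  by rewrite normrM (ger0_norm eta0) lerD2r.
by have := ler_wpM2l eta0 IH; lra.
Qed.

(* [eta] is chosen so that the tails of two expansions, of total length at most
   [2 * B * eta / (1 - eta) = g], cannot undo a gap [g] in the first digit. *)
Lemma digits_sum_separated (R : realType) (d : nat) (I : eqType) (eta B g : R)
    (p : I -> 'rV[R]_d) (z : I -> I -> 'rV[R]_d) :
  0 <= eta < 1 -> 0 <= g -> g * (1 - eta) = 2 * B * eta ->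
  (forall i j l, `|dotv (p l) (z i j)| <= B) ->
  (forall i j, i != j -> g < `|dotv (p i - p j) (z i j)|) ->
  forall s t, size s = size t -> s != t -> exists i j,
    g * eta ^+ size s <=
    `|dotv (digits_sum eta p s - digits_sum eta p t) (z i j)|.
Proof.
move=> /andP[eta0 eta1] g0 etaE pB psep; elim=> [|i s IH] [|j t]//= [] st.
(* A common leading digit cancels, and the remaining difference is scaled by [eta]. *)
have [<-|ij] := eqVneq i j.
  rewrite eqseq_cons eqxx /= => /(IH _ st)[k [l kl]]; exists k, l.
  rewrite opprD addrACA subrr add0r -scalerBr dotvZ normrM (ger0_norm eta0).
  by rewrite exprS mulrCA ler_wpM2l.
move=> _; exists i, j.
have := psep i j ij.
have := @norm_digits_sum _ _ _ eta p (z i j) B s.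
have := @norm_digits_sum _ _ _ eta p (z i j) B t.
rewrite eta0 (ltW eta1) -st => /(_ isT (pB i j)) Ht /(_ isT (pB i j)) Hs Hij.
rewrite !dotvB !dotvD !dotvZ in Hij *.
set a := dotv (p i) _ in Hij *; set b := dotv (p j) _ in Hij *.
set u := dotv _ _ in Hs *; set v := dotv _ _ in Ht *.
(* With the leading gap above [g], this leaves at least [g * eta ^+ size s], more than the exponent
   [(size s).+1] asks for. *)
have tail : eta * (`|u| + `|v|) <= g * (1 - eta ^+ size s).
  rewrite -(ler_pM2l (_ : 0 < 1 - eta)) ?subr_gt0//.
  have -> : (1 - eta) * (g * (1 - eta ^+ size s)) =
      2 * B * eta * (1 - eta ^+ size s) by rewrite -etaE; ring.
  by have := ler_wpM2l eta0 (lerD Hs Ht); lra.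
have := ler_normB (a + eta * u - (b + eta * v)) (eta * u - eta * v).
have -> : a + eta * u - (b + eta * v) - (eta * u - eta * v) = a - b by ring.
have := ler_normB (eta * u) (eta * v); rewrite !normrM !(ger0_norm eta0).
have : g * eta ^+ (size s).+1 <= g * eta ^+ size s.
  by rewrite ler_wpM2l// exprS ler_piMl ?exprn_ge0// ltW.
by lra.
Qed.

(** The vector [z i j] witnesses the separation of [p i] and [p j]. The coordinate bound [C] enters
    only the factor independent of [s], so it vanishes in the limit. *)
Lemma packing_bound (R : realType) (d M : nat) (B g C : R)
    (p : 'I_M -> 'rV[R]_d) (z : 'I_M -> 'I_M -> 'rV[R]_d) :
  0 <= B -> 0 < g ->
  (forall i k, `|p i ord0 k| <= C) ->
  (forall i j l, `|dotv (p l) (z i j)| <= B) ->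
  (forall i j, i != j -> g < `|dotv (p i - p j) (z i j)|) ->
  M%:R <= (1 + 2 * B / g) ^+ d.
Proof.
move=> B0 g0 pC pB psep; set q := 1 + 2 * B / g.
have q1 : 1 <= q by rewrite /q lerDl divr_ge0 ?(ltW g0)// mulr_ge0.
have q0 : 0 < q by apply: lt_le_trans q1.
case: M p z pC pB psep => [|[|M]] p z pC pB psep.
- by rewrite exprn_ge0// ltW.
- by rewrite exprn_ege1.
(* Two distinct points are at hand, so [g < 2 * B]; hence [q > 1] and [eta < 1]. *)
have {}B0 : 0 < B.
  have := psep ord0 ord_max isT; rewrite dotvB => /lt_le_trans/(_ (ler_normB _ _)).
  have := pB ord0 ord_max ord0; have := pB ord0 ord_max ord_max; lra.
have {}q1 : 1 < q by rewrite /q ltrDl divr_gt0// mulr_gt0.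
pose eta := q^-1.
have eta0 : 0 < eta by rewrite invr_gt0.
have eta1 : eta < 1 by rewrite invf_lt1.
have etaE : g * (1 - eta) = 2 * B * eta.
  apply: (mulIf (lt0r_neq0 q0)).
  rewrite -!mulrA mulVf ?lt0r_neq0// mulrBl mulVf ?lt0r_neq0//.
  by rewrite /q; field; rewrite lt0r_neq0.
(* The geometric series bounds the coordinates of digit sums of every length by [E]. *)
pose E := `|C| / (1 - eta).
have eta1' : 0 < 1 - eta by rewrite subr_gt0.
have E0 : 0 <= E by rewrite divr_ge0// ltW.
(* [A] strictly exceeds the l1 norm of every [z i j], so sums within [g * eta ^+ s / A] in each
   coordinate pair with every [z i j] to within less than [g * eta ^+ s]. *)
pose A := 1 + \sum_i \sum_j \sum_k `|z i j ord0 k|.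
have A1 : 1 <= A.
  rewrite lerDl !sumr_ge0// => i _.
  by rewrite !sumr_ge0// => j _; rewrite sumr_ge0.
have A0 : 0 < A by apply: lt_le_trans A1.
have zA i j : \sum_k `|z i j ord0 k| < A.
  rewrite /A (bigD1 i)//= (bigD1 j)//=.
  have : 0 <= \sum_(l | l != j) \sum_k `|z i l ord0 k|.
    by rewrite sumr_ge0// => l _; rewrite sumr_ge0.
  have : 0 <= \sum_(m | m != i) \sum_l \sum_k `|z m l ord0 k|.
    by rewrite sumr_ge0// => m _; rewrite sumr_ge0// => l _; rewrite sumr_ge0.
  by lra.
have count_le s : M.+2%:R ^+ s <= (2 * E / (g * eta ^+ s / A) + 1) ^+ d.
  have gs : 0 < g * eta ^+ s by rewrite mulr_gt0// exprn_gt0.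
  rewrite -natrX -[M.+2 in leLHS]card_ord -card_tuple.
  apply: (@card_le_cells _ _ _ (fun u : s.-tuple 'I_M.+2 => digits_sum eta p u)) => //.
  - by rewrite divr_gt0.
  - move=> u k; rewrite -dotv_delta /E ler_pdivlMr// mulrC.
    apply: le_trans (norm_digits_sum (B := `|C|) _ _ _) _.
    + by rewrite !ltW.
    + by move=> i; rewrite dotv_delta (le_trans (pC i k))// ler_norm.
    + by rewrite ler_piMr// lerBlDr lerDl exprn_ge0// ltW.
  move=> u v uv; apply/eqP/negP => /negP uDv.
  have eta01 : 0 <= eta < 1 by rewrite (ltW eta0).
  have suv : size u = size v by rewrite !size_tuple.
  have [i [j]] := digits_sum_separated eta01 (ltW g0) etaE pB psep suv uDv.
  rewrite size_tuple leNgt => /negP; apply.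
  apply: le_lt_trans (ler_norm_dotv _ uv) _.
  by rewrite mulrAC ltr_pdivrMr// ltr_pM2l.
have F0 : 0 <= 2 * E * A / g.
  by rewrite divr_ge0 ?(ltW g0)// mulr_ge0 ?(ltW A0)// mulr_ge0.
(* The summand 1 is absorbed through [1 <= q ^+ s]. *)
have qpow s : (M.+2%:R / q ^+ d) ^+ s <= (2 * E * A / g + 1) ^+ d.
  rewrite expr_div_n -exprM ler_pdivrMr ?exprn_gt0//.
  apply: le_trans (count_le s) _; rewrite mulnC exprM -exprMn lerXn2r ?nnegrE//.
  - rewrite addr_ge0// divr_ge0//; first exact: mulr_ge0.
    by rewrite divr_ge0 ?(ltW A0)// mulr_ge0 ?exprn_ge0// ltW.
  - by rewrite mulr_ge0 ?addr_ge0 ?exprn_ge0 ?(ltW q0).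
  rewrite [leRHS]mulrDl mul1r lerD ?exprn_ege1 ?(ltW q1)//.
  rewrite le_eqVlt; apply/orP; left; apply/eqP.
  by rewrite /eta exprVn; field; rewrite !lt0r_neq0// exprn_gt0.
have := le1_of_bounded_powers qpow.
by rewrite ler_pdivrMr ?exprn_gt0// mul1r.
Qed.

(** * Covers from maximal packings *)

Lemma exists_cover (R : realType) (d : nat) (K X : set 'rV[R]_d) (B g C : R) :
  0 <= B -> 0 < g ->
  (forall w k, K w -> `|w ord0 k| <= C) ->
  (forall w x, K w -> X x -> `|dotv w x| <= B) ->
  exists (M : nat) (p : 'I_M -> 'rV[R]_d),
    M%:R <= (1 + 2 * B / g) ^+ d /\
    forall w, K w -> exists i, forall x, X x -> `|dotv (w - p i) x| <= g.
Proof.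
move=> B0 g0 KC KB.
pose packing M (p : 'I_M -> 'rV[R]_d) := (forall i, K (p i)) /\
  forall i j, i != j -> exists2 x, X x & g < `|dotv (p i - p j) x|.
have bound M (p : 'I_M -> 'rV[R]_d) : packing M p -> M%:R <= (1 + 2 * B / g) ^+ d.
  move=> [pK psep].
  have /choice[z zP] : forall ij : 'I_M * 'I_M, exists x,
      (forall l, `|dotv (p l) x| <= B) /\
      (ij.1 != ij.2 -> g < `|dotv (p ij.1 - p ij.2) x|).
    move=> [i j] /=; have [->|ij] := eqVneq i j.
      (* On the diagonal nothing has to be separated, and 0 meets the bound [B]. *)
      by exists 0; split=> // l; rewrite dotv0r normr0.
    by have [x Xx gx] := psep i j ij; exists x; split=> // l; exact: KB.
  apply: (@packing_bound _ _ _ B g C p (fun i j => z (i, j))) => //.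
  - by move=> i k; exact: KC.
  - by move=> i j l; have [] := zP (i, j).
  - by move=> i j; have [] := zP (i, j).
have ex0 : exists M, `[< exists p, packing M p >].
  by exists 0%N; apply/asboolP; exists (fun=> 0); split=> -[].
have q0 : 0 <= (1 + 2 * B / g) ^+ d.
  by rewrite exprn_ge0// addr_ge0// divr_ge0 ?(ltW g0)// mulr_ge0.
have ub M : `[< exists p, packing M p >] -> (M <= Num.truncn ((1 + 2 * B / g) ^+ d))%N.
  by move=> /asboolP[p /bound]; rewrite truncn_ge_nat.
have [M /asboolP[p pP] Mmax] := ex_maxnP ex0 ub.
exists M, p; split; first exact: bound pP.
move=> w Kw; apply: contrapT => /forallNP nw.
suff : (M.+1 <= M)%N by rewrite ltnn.
have far i : exists2 x, X x & g < `|dotv (w - p i) x|.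
  have /existsNP[x /not_implyP[Xx /negP]] := nw i.
  by rewrite -ltNge => gx; exists x.
apply: Mmax; apply/asboolP.
(* An uncovered [w], put at index 0, would enlarge the maximal packing. *)
exists (fun k => if unlift ord0 k is Some i then p i else w).
case: pP => pK psep; split=> [k|k l]; first by case: unliftP => [i|] _.
case: (unliftP ord0 k) => [i|] ->; case: (unliftP ord0 l) => [j|] -> //= kl.
- by apply: psep; apply: contraNneq kl => ->.
- have [x Xx] := far i; rewrite -normrN => gx; exists x => //.
  by move: gx; rewrite !dotvB opprB.
Qed.

(** * Norm and dual norm *)

Lemma is_norm_ge0 (R : realType) (d : nat) (N : 'rV[R]_d -> R) x :
  is_norm N -> 0 <= N x.
Proof.
move=> [_ NZ ND]; have := ND x (- x).
have N0 : N 0 = 0 by rewrite -(scale0r 0) NZ normr0 mul0r.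
rewrite subrr N0 -scaleN1r NZ normrN1 mul1r; lra.
Qed.

(* [sup] of an unbounded set is [0], so [dual_norm N w = 1] already entails that
   the defining supremum is finite. *)
Lemma dual_norm1_le (R : realType) (d : nat) (N : 'rV[R]_d -> R) w x :
  is_norm N -> dual_norm N w = 1 -> `|dotv w x| <= N x.
Proof.
move=> nN w1; have [Nx0 NZ _] := nN.
have hs : has_sup [set dotv w x | x in [set x | N x <= 1]].
  apply: contrapT => /sup_out; rewrite -/(dual_norm N w) w1 => /eqP.
  by rewrite oner_eq0.
have unit_le u : N u <= 1 -> dotv w u <= 1.
  by move=> u1; rewrite -w1; apply: sup_upper_bound => //; exists u.
have dot_le u : dotv w u <= N u.
  have [/Nx0 ->|Nu] := eqVneq (N u) 0; first by rewrite dotv0r is_norm_ge0.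
  have Npos : 0 < N u by rewrite lt0r Nu is_norm_ge0.
  have := unit_le ((N u)^-1 *: u).
  rewrite NZ ger0_norm ?invr_ge0 ?is_norm_ge0// mulVf// lexx dotvZr => /(_ isT).
  by rewrite mulrC ler_pdivrMr// mul1r.
rewrite ler_norml dot_le andbT lerNl -mulN1r -dotvZr.
by apply: le_trans (dot_le _) _; rewrite NZ normrN1 mul1r.
Qed.

(** * The regret bound *)

Theorem theorem14 (R : realType) (d : nat) (N : 'rV[R]_d -> R)
  (X : set 'rV[R]_d) (gamma : R) (T : nat) :
  is_norm N ->
  has_ubound [set N x | x in X] ->
  0 < gamma ->
  exists L : learner R d,
    (forall h x, 0 <= L h x <= 1) /\
    forall (x : nat -> 'rV[R]_d) (y : nat -> bool),
      (forall t, (t < T)%N -> X (x t)) ->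
      forall w : 'rV[R]_d, dual_norm N w = 1 ->
        \sum_(t < T) exp_mistake L x y t
          - \sum_(t < T) margin_err gamma w x y t
        <= Num.sqrt (T%:R * (d%:R *
             ln (1 + 2 * sup [set N x | x in X] / gamma))).
Proof.
move=> nN Xub g0; set B := sup _.
have NB x : X x -> N x <= B by move=> Xx; apply: ub_le_sup => //; exists x.
have B0 : 0 <= B.
  have [X0|/set0P[x Xx]] := eqVneq X set0; first by rewrite /B X0 image_set0 sup0.
  exact: le_trans (is_norm_ge0 x nN) (NB x Xx).
set q := 1 + 2 * B / gamma; set Lam := d%:R * ln q.
have q1 : 1 <= q by rewrite /q lerDl divr_ge0 ?(ltW g0)// mulr_ge0.
have q0 : 0 < q by apply: lt_le_trans q1.
have Lam0 : 0 <= Lam by rewrite mulr_ge0// ln_ge0.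
have margin_ge0 w x y t : 0 <= margin_err gamma w x y t.
  by rewrite /margin_err; case: ifP.
(* Otherwise the learning rate [2 * sqrt (Lam / T)] below is positive and at most [1]. *)
have [small|] := boolP ((T%:R <= 4 * Lam) || (Lam == 0)).
  exists (fun _ _ => 1 / 2); split=> [h x|x y xX w w1].
    by apply/andP; split; lra.
  have -> : \sum_(t < T) exp_mistake (fun _ _ => 1 / 2) x y t = T%:R / 2.
    rewrite (eq_bigr (fun=> 1 / 2)) => [|t _]; last first.
      by rewrite /exp_mistake; case: (y t) => //; lra.
    by rewrite sumr_const card_ord -mulr_natr; lra.
  case/orP: small => [TL|/eqP L0].
    (* [T <= 4 * Lam] gives [(T / 2) ^+ 2 <= T * Lam]. *)
    apply: (@le_trans _ _ (T%:R / 2)); first by rewrite gerBl sumr_ge0.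
    have T0 : 0 <= T%:R / 2 :> R by rewrite divr_ge0.
    rewrite -[leLHS]ger0_norm// -sqrtr_sqr ler_wsqrtr//.
    by have := ler_wpM2l (ler0n R T) TL; lra.
  (* [Lam = 0] means [d = 0] or [B = 0]. Every [dotv w (x t)] is then 0, so [w] fails the margin in
     all rounds and the regret is [T / 2 - T <= 0]. *)
  apply: le_trans (sqrtr_ge0 _); rewrite (eq_bigr (fun=> 1)) => [|t _].
    by rewrite sumr_const card_ord -mulr_natr mul1r; have := ler0n R T; lra.
  rewrite /margin_err (_ : dotv w (x t) = 0) ?mulr0 ?ltW//.
  have /orP[d0|/eqP lnq] : ((d == 0%N) || (ln q == 0)).
    by move/eqP: L0; rewrite mulf_eq0 pnatr_eq0.
    rewrite /dotv big1// => k _.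
    by have := leq_ltn_trans (leq0n k) (ltn_ord k); rewrite lt0n d0.
  have {}B0 : B = 0.
    move/eqP: lnq; rewrite ln_eq0// /q addrC -subr_eq0 addrK.
    by rewrite !mulf_eq0 invr_eq0 (gt_eqF g0) orbF pnatr_eq0 /= => /eqP.
  apply/normr0_eq0/le_anti; rewrite normr_ge0 andbT -B0.
  exact: le_trans (dual_norm1_le (x t) nN w1) (NB _ (xX t (ltn_ord t))).
rewrite negb_or -ltNge => /andP[TL Ln0].
have Lpos : 0 < Lam by rewrite lt0r Ln0.
have Tpos : 0 < T%:R :> R by lra.
pose K : set 'rV[R]_d := [set w | forall x, `|dotv w x| <= N x].
pose C := \sum_k N (delta_mx ord0 k).
have [||M [p [Mq pcover]]] := @exists_cover _ d K X B gamma C B0 g0.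
- move=> w k Kw; rewrite -dotv_delta; apply: le_trans (Kw _) _.
  by rewrite /C (bigD1 k)//= lerDl sumr_ge0// => l _; exact: is_norm_ge0.
- by move=> w x Kw Xx; exact: le_trans (Kw x) (NB x Xx).
(* [a = 2 * s] minimises [Lam / a + T * a / 4]; both terms then equal [T * s / 2]. *)
pose s := Num.sqrt (Lam / T%:R).
have s0 : 0 < s by rewrite sqrtr_gt0 divr_gt0.
have LamE : Lam = T%:R * s ^+ 2.
  by rewrite sqr_sqrtr ?divr_ge0 ?ltW// mulrC divfK ?lt0r_neq0.
have a01 : 0 < 2 * s <= 1.
  rewrite mulr_gt0//=; have : T%:R * (4 * s ^+ 2) < T%:R * 1 by lra.
  by rewrite ltr_pM2l//; nra.
pose e i x := 0 < dotv (p i) x.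
exists (hedge (2 * s) e); split=> [h x|x y xX w w1]; first exact: hedge_in01.
have [i wi] : exists i, forall x, X x -> `|dotv (w - p i) x| <= gamma.
  by apply: pcover => x'; exact: dual_norm1_le.
(* Where [w] has margin above [gamma], a change of at most [gamma] in the pairing keeps its sign, so
   expert [i] is right. *)
have expert_le : \sum_(t < T) (e i (x t) != y t)%:R <=
    \sum_(t < T) margin_err gamma w x y t.
  apply: ler_sum => t _; rewrite /margin_err /e /sgn.
  have := wi _ (xX t (ltn_ord t)); rewrite dotvB ler_norml => /andP[lo hi].
  by case: (y t); case: ltrP => pt; case: (lerP _ gamma) => wt //=; lra.
have lnM : ln M%:R <= Lam.
  have M0 : 0 < M%:R :> R by rewrite ltr0n (leq_ltn_trans _ (ltn_ord i)).
  have -> : Lam = ln (q ^+ d) by rewrite lnXn// /Lam mulr_natl.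
  by rewrite ler_ln ?posrE ?exprn_gt0.
apply: le_trans (lerB (lexx _) expert_le) _.
apply: le_trans (hedge_regret e x y T i a01) _.
have -> : Num.sqrt (T%:R * Lam) = T%:R * s.
  by rewrite LamE mulrA -expr2 -exprMn sqrtr_sqr ger0_norm// mulr_ge0// ltW.
have : ln M%:R / (2 * s) <= T%:R * s / 2.
  rewrite ler_pdivrMr ?mulr_gt0//; apply: le_trans lnM _.
  by rewrite LamE; lra.
by lra.
Qed.
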